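(* Let $\alpha=\sqrt[3]{8119+48\sqrt{22535}}$. The maximal real number $\lambda>0$ such that $$\frac{1}{x_1}+\frac{1}{x_2}+\frac{1}{x_3}+\frac{1}{x_4}+\frac{1}{x_5}\ \ge\ \frac{\lambda}{1+125(\lambda-25)x_1x_2x_3x_4x_5}$$ holds for all real $x_1,x_2,x_3,x_4,x_5>0$ with $x_1+x_2+x_3+x_4+x_5=1$ is $$\lambda_5=\frac{12933567-93093\sqrt{22535}}{4135801}\,\alpha+\frac{17887113+560211\sqrt{22535}}{996728041}\,\alpha^2-\frac{288017}{17161}.$$ Moreover, for $\lambda=\lambda_5$, equality in this inequality occurs when $x_1=x_2=x_3=x_4=x_5=\frac15$ and also when $x_1=x_2=x_3=x_4=x$, $x_5=1-4x$, where $$x=\frac{\alpha}{240}+\frac{241}{240\alpha}+\frac{7}{240}.$$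
   Context: All roots are real roots. (Numerically $\lambda_5\approx 40.09$, $x\approx 0.173$.) *)

(* Defs.v *)
From Stdlib Require Import Reals.
Open Scope R_scope.

Definition in_domain (x1 x2 x3 x4 x5 : R) : Prop :=
  0 < x1 /\ 0 < x2 /\ 0 < x3 /\ 0 < x4 /\ 0 < x5 /\
  x1 + x2 + x3 + x4 + x5 = 1.

Definition lhs (x1 x2 x3 x4 x5 : R) : R :=
  1 / x1 + 1 / x2 + 1 / x3 + 1 / x4 + 1 / x5.

(* On [in_domain] the product of the [xi] is at most 1/3125, so for
   [lambda > 0] the denominator is positive and the division is genuine. *)
Definition rhs (lambda x1 x2 x3 x4 x5 : R) : R :=
  lambda / (1 + 125 * (lambda - 25) * (x1 * x2 * x3 * x4 * x5)).

Definition admissible (lambda : R) : Prop :=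
  0 < lambda /\
  forall x1 x2 x3 x4 x5 : R,
    in_domain x1 x2 x3 x4 x5 ->
    lhs x1 x2 x3 x4 x5 >= rhs lambda x1 x2 x3 x4 x5.

Definition is_maximum (E : R -> Prop) (m : R) : Prop :=
  E m /\ is_upper_bound E m.

Definition equality_at (lambda x1 x2 x3 x4 x5 : R) : Prop :=
  in_domain x1 x2 x3 x4 x5 /\
  lhs x1 x2 x3 x4 x5 = rhs lambda x1 x2 x3 x4 x5.

(* [Rpower t (1 / 3)] is the real cube root of [t] for [t > 0]. *)
Definition alpha : R := Rpower (8119 + 48 * sqrt 22535) (1 / 3).

Definition lambda5 : R :=
  (12933567 - 93093 * sqrt 22535) / 4135801 * alpha
  + (17887113 + 560211 * sqrt 22535) / 996728041 * alpha ^ 2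
  - 288017 / 17161.

Definition xeq : R := alpha / 240 + 241 / (240 * alpha) + 7 / 240.

(* Main.v *)
Require Import Defs.
From Stdlib Require Import Reals.
From Stdlib Require Import Lra Lia List Permutation.
Import ListNotations.
Open Scope R_scope.

(** Write [S] for the sum of the reciprocals and [p] for the product of the
    five variables.  The right-hand side depends on [p] alone, so the question
    is how small [S] can be when the sum and the product are prescribed.  The
    answer ([sum_inv_ge]) is that [S] is least at a point [(t, t, t, t, u)]
    with [t <= u].  As long as no variable equals [t],
    some three of them satisfy [a < t <= b, c], and such a
    triple can be replaced by [(t, b', c')] with the same sum and product and a
    smaller sum of reciprocals ([smoothing_step]); the value [t] is then
    dropped and the number of variables goes down.  A suitable [t] exists by
    the intermediate value theorem, because [p <= 1 / 5 ^ 5].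

    On the line [(t, t, t, t, 1 - 4 t)] the inequality, cleared of its positive
    denominators, reads [(1 - 5 t) ^ 2 * (4 - (lambda - 25) * D t) >= 0] with
    the quartic [D] below ([diagonal_identity]).  Hence the best constant is
    [25 + 4 / max D], and the maximum of [D] is attained where [D' = 0], that
    is, at the real root of [1200 x ^ 3 = 105 x ^ 2 + 12 x + 1].  Cardano's
    formula for this cubic is [xeq] ([xeq_critical]), and evaluating
    [25 + 4 / D xeq] in the field generated by [alpha] gives [lambda5]
    ([lambda5_D]). *)

(** * Sums and products of lists *)

Definition sum (xs : list R) : R := fold_right Rplus 0 xs.
Definition prod (xs : list R) : R := fold_right Rmult 1 xs.

Lemma sum_permutation xs ys : Permutation xs ys -> sum xs = sum ys.
Proof. induction 1; simpl in *; lra. Qed.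

Lemma prod_permutation xs ys : Permutation xs ys -> prod xs = prod ys.
Proof.
  induction 1; simpl in *; [reflexivity | now f_equal | ring | congruence].
Qed.

Lemma prod_pos xs : Forall (Rlt 0) xs -> 0 < prod xs.
Proof.
  induction 1; simpl; [lra | now apply Rmult_lt_0_compat].
Qed.

Lemma Exists_permutation (P : R -> Prop) xs :
  Exists P xs -> exists x ys, P x /\ Permutation xs (x :: ys).
Proof.
  intros H. apply Exists_exists in H. destruct H as (x & Hin & Hx).
  apply in_split in Hin. destruct Hin as (l1 & l2 & ->).
  exists x, (l1 ++ l2). split; [exact Hx |].
  apply Permutation_sym, Permutation_middle.
Qed.

Lemma sum_le_length t xs :
  Forall (fun x => x < t) xs -> sum xs <= INR (length xs) * t.
Proof.
  induction 1; [simpl; lra |].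
  change (length (x :: l)) with (S (length l)). rewrite S_INR. simpl. nra.
Qed.

(** The AM-GM inequality in exponential form, from [1 + z <= exp z] with
    [z = x / t - 1]; taking for [t] the mean of [xs] makes the exponent
    vanish. *)
Lemma prod_le_exp t xs :
  0 < t -> Forall (Rlt 0) xs ->
  prod xs <= t ^ length xs * exp (sum xs / t - INR (length xs)).
Proof.
  intros Ht. induction 1 as [| x l Hx Hl IH].
  - simpl. replace (0 / t - 0) with 0 by (field; lra). rewrite exp_0. lra.
  - change (length (x :: l)) with (S (length l)). rewrite S_INR. simpl.
    replace ((x + sum l) / t - (INR (length l) + 1))
      with ((x / t - 1) + (sum l / t - INR (length l))) by (field; lra).
    rewrite exp_plus.
    assert (H : x <= t * exp (x / t - 1)).
    { pose proof (exp_ineq1_le (x / t - 1)).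
      replace x with (t * (1 + (x / t - 1))) at 1 by (field; lra).
      apply Rmult_le_compat_l; lra. }
    replace (t * t ^ length l *
        (exp (x / t - 1) * exp (sum l / t - INR (length l))))
      with ((t * exp (x / t - 1)) *
        (t ^ length l * exp (sum l / t - INR (length l)))) by ring.
    apply Rmult_le_compat; [lra | | exact H | exact IH].
    apply Rlt_le, prod_pos, Hl.
Qed.

(** * The least sum of reciprocals for a given sum and product *)

(** Moving one entry [y > t] down to [t] and giving the difference to [c > t]
    lowers the product, since [c * y - t * (c + y - t) = (c - t) * (y - t)]. *)
Lemma prod_gt_of_all_above t ys :
  0 < t -> forall y c, t < c -> t < y -> Forall (Rlt t) ys ->
  t ^ S (length ys) * (c + (y + sum ys) - INR (S (length ys)) * t)
  < c * (y * prod ys).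
Proof.
  intros Ht. induction ys as [| z ys IH]; intros y c Hc Hy Hys.
  - simpl. nra.
  - inversion Hys as [| ? ? Hz Hys']; subst.
    specialize (IH z (c + y - t) ltac:(lra) Hz Hys').
    change (length (z :: ys)) with (S (length ys)). rewrite (S_INR (S _)).
    assert (Hp : 0 < z * prod ys).
    { apply Rmult_lt_0_compat; [lra |]. apply prod_pos.
      eapply Forall_impl; [| exact Hys']. simpl; intros; lra. }
    apply Rlt_trans with (t * ((c + y - t) * (z * prod ys))).
    + apply (Rmult_lt_compat_l t) in IH; [| lra].
      eapply Rle_lt_trans; [| exact IH]. right. simpl. ring.
    + simpl.
      assert (0 < (c - t) * (y - t)) by (apply Rmult_lt_0_compat; lra).
      replace (c * (y * (z * prod ys))) with (c * y * (z * prod ys)) by ring.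
      replace (t * ((c + y - t) * (z * prod ys)))
        with (t * (c + y - t) * (z * prod ys)) by ring.
      apply Rmult_lt_compat_r; lra.
Qed.

(** Here an entry [y < t] is moved up to [t] at the expense of [c].  The
    hypothesis that [c] is still at least [t] after all these moves ensures
    [c > t] at each of them, so that each one raises the product. *)
Lemma prod_lt_of_all_below t ys :
  0 < t -> forall y c, 0 < y < t -> Forall (Rlt 0) ys ->
  Forall (fun z => z < t) ys ->
  t <= c + (y + sum ys) - INR (S (length ys)) * t ->
  c * (y * prod ys)
  < t ^ S (length ys) * (c + (y + sum ys) - INR (S (length ys)) * t).
Proof.
  intros Ht. induction ys as [| z ys IH]; intros y c Hy Hpos Hys Hc.
  - simpl in *. nra.
  - pose proof (sum_le_length t (z :: ys) Hys) as Hsum.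
    inversion Hys as [| ? ? Hz Hys']; subst.
    inversion Hpos as [| ? ? Hz0 Hpos']; subst.
    change (length (z :: ys)) with (S (length ys)) in *.
    rewrite (S_INR (S _)) in *.
    simpl sum in *. simpl prod.
    specialize (IH z (c + y - t) ltac:(lra) Hpos' Hys' ltac:(lra)).
    assert (Hp : 0 < z * prod ys)
      by (apply Rmult_lt_0_compat; [lra | now apply prod_pos]).
    apply Rlt_trans with (t * ((c + y - t) * (z * prod ys))).
    + assert (0 < (c - t) * (t - y)) by (apply Rmult_lt_0_compat; lra).
      replace (c * (y * (z * prod ys))) with (c * y * (z * prod ys)) by ring.
      replace (t * ((c + y - t) * (z * prod ys)))
        with (t * (c + y - t) * (z * prod ys)) by ring.
      apply Rmult_lt_compat_r; lra.
    + apply (Rmult_lt_compat_l t) in IH; [| lra].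
      eapply Rlt_le_trans; [exact IH |]. right. simpl. ring.
Qed.

(** Put [Q T = (T - a) * (T - b) * (T - c)], so that [Q t >= 0].  The cubic
    [Q T - (Q t / t) * T] has the same sum and product of roots, has [t] as a
    root, and its sum of pairwise products is smaller by [Q t / t].  Its value
    at [c] is at most [0]; if [c > t], so is that of the quadratic left after
    dividing by [T - t], which therefore has real roots.  If [c = t], the
    triple is only reordered. *)
Lemma smoothing_step t a b c :
  0 < a -> a < t -> t <= b -> t <= c ->
  exists b' c', 0 < b' /\ 0 < c' /\ t + b' + c' = a + b + c /\
    t * b' * c' = a * b * c /\
    / t + / b' + / c' <= / a + / b + / c.
Proof.
  intros Ha Hat Hb Hc.
  destruct (Rle_lt_or_eq_dec t c Hc) as [Hc' | <-].
  2: { exists a, b. repeat split; lra. }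
  set (s := a + b + c - t). set (q := a * b * c / t).
  assert (Hab : 0 < a * b) by (apply Rmult_lt_0_compat; lra).
  assert (Habc : 0 < a * b * c) by (apply Rmult_lt_0_compat; lra).
  assert (Hq : 0 < q) by (unfold q; apply Rdiv_lt_0_compat; lra).
  assert (Hqt : t * q = a * b * c) by (unfold q; field; lra).
  set (Qt := (t - a) * (t - b) * (t - c)).
  assert (HQt : 0 <= Qt).
  { unfold Qt. replace ((t - a) * (t - b) * (t - c))
      with ((t - a) * ((b - t) * (c - t))) by ring.
    apply Rmult_le_pos; [lra | apply Rmult_le_pos; lra]. }
  (* the remaining quadratic at [c]: nonpositive, so its discriminant is >= 0 *)
  assert (Hquad : c * c - s * c + q <= 0).
  { assert (E : (c * c - s * c + q) * ((c - t) * t) = - Qt * c).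
    { replace ((c * c - s * c + q) * ((c - t) * t))
        with (((c * c - s * c) * t + t * q) * (c - t)) by ring.
      rewrite Hqt. unfold s, Qt. ring. }
    assert (0 <= Qt * c) by (apply Rmult_le_pos; lra).
    assert (0 < (c - t) * t) by (apply Rmult_lt_0_compat; lra).
    destruct (Rle_lt_dec (c * c - s * c + q) 0) as [? | H1]; [assumption |].
    pose proof (Rmult_lt_0_compat _ _ H1 H0). lra. }
  assert (Hdisc : 0 <= s * s - 4 * q).
  { pose proof (Rle_0_sqr (2 * c - s)) as H. unfold Rsqr in H. lra. }
  set (r := sqrt (s * s - 4 * q)).
  assert (Hr : r * r = s * s - 4 * q) by (apply sqrt_sqrt, Hdisc).
  assert (Hr0 : 0 <= r) by apply sqrt_pos.
  assert (Hs : 0 < s) by (unfold s; lra).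
  assert (Hrs : r < s) by nra.
  assert (Hprod : (s - r) / 2 * ((s + r) / 2) = q).
  { replace ((s - r) / 2 * ((s + r) / 2)) with ((s * s - r * r) / 4) by field.
    rewrite Hr. field. }
  exists ((s - r) / 2), ((s + r) / 2).
  split; [lra |]. split; [lra |]. split; [unfold s; lra |].
  split; [rewrite Rmult_assoc, Hprod; exact Hqt |].
  (* both sides are the sum of pairwise products over [a * b * c] *)
  assert (EL : / t + / ((s - r) / 2) + / ((s + r) / 2)
    = (q + t * s) / (a * b * c)).
  { rewrite <- Hqt, <- Hprod. field. lra. }
  assert (ER : / a + / b + / c = (a * b + b * c + c * a) / (a * b * c))
    by (field; lra).
  rewrite EL, ER. unfold Rdiv. apply Rmult_le_compat_r.
  - apply Rlt_le, Rinv_0_lt_compat, Habc.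
  - assert (E : t * (a * b + b * c + c * a - q - t * s) = Qt).
    { replace (t * (a * b + b * c + c * a - q - t * s))
        with (t * (a * b + b * c + c * a - t * s) - t * q) by ring.
      rewrite Hqt. unfold s, Qt. ring. }
    destruct (Rle_lt_dec (q + t * s) (a * b + b * c + c * a)); [assumption |].
    pose proof (Rmult_lt_0_compat t (q + t * s - (a * b + b * c + c * a))).
    lra.
Qed.

(** Among positive lists with the sum and product of [t, ..., t, u], [t <= u],
    that list has the least sum of reciprocals.  The induction removes one
    entry equal to [t] at a time; if there is none, the two product
    comparisons above force one entry below [t] and two above, and
    [smoothing_step] creates an entry [t]. *)
Lemma sum_inv_ge n : forall t u xs,
  0 < t <= u -> length xs = S n -> Forall (Rlt 0) xs ->
  sum xs = INR n * t + u -> prod xs = t ^ n * u ->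
  INR n / t + / u <= sum (map Rinv xs).
Proof.
  induction n as [| n IH]; intros t u xs Htu Hlen Hpos Hsum Hprod.
  - destruct xs as [| x [| ? ?]]; try discriminate.
    simpl in *. unfold Rdiv. replace x with u by lra. lra.
  - assert (Hle : Exists (fun x => x <= t) xs).
    { destruct (Exists_dec (fun x => x <= t) xs) as [H | H];
        [intros x; apply Rle_dec | exact H |].
      apply Forall_Exists_neg in H. exfalso.
      destruct xs as [| c [| y ys]]; try discriminate.
      injection Hlen as Hlen.
      assert (H' : Forall (Rlt t) (c :: y :: ys))
        by (eapply Forall_impl; [| exact H]; simpl; intros; lra).
      inversion H' as [| ? ? Hc H1]; subst.
      inversion H1 as [| ? ? Hy Hys]; subst.
      pose proof (prod_gt_of_all_above t ys ltac:(lra) y c Hc Hy Hys) as K.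
      simpl sum in *. simpl prod in *.
      replace (c + (y + sum ys) - INR (S (length ys)) * t) with u in K by lra.
      lra. }
    apply Exists_permutation in Hle. destruct Hle as (a & ys & Hat & P1).
    assert (Hlen1 : length ys = S n)
      by (apply Permutation_length in P1; simpl in P1; lia).
    pose proof (Permutation_Forall P1 Hpos) as Hpos1.
    rewrite (sum_permutation _ _ P1) in Hsum.
    rewrite (prod_permutation _ _ P1) in Hprod.
    rewrite (sum_permutation _ _ (Permutation_map Rinv P1)).
    clear P1 xs Hlen Hpos.
    rewrite S_INR in Hsum |- *.
    inversion Hpos1 as [| ? ? Ha Hpos2]; subst. simpl in Hsum, Hprod |- *.
    destruct (Rle_lt_or_eq_dec a t Hat) as [Hlt | ->].
    2: { assert (Hp : prod ys = t ^ n * u)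
           by (apply Rmult_eq_reg_l with t; lra).
         specialize (IH t u ys Htu Hlen1 Hpos2 ltac:(lra) Hp).
         unfold Rdiv in *. lra. }
    assert (Hex : Exists (Rle t) ys).
    { destruct (Exists_dec (Rle t) ys) as [H | H];
        [intros x; apply Rle_dec | exact H |].
      apply Forall_Exists_neg in H. exfalso.
      assert (H' : Forall (fun z => z < t) ys)
        by (eapply Forall_impl; [| exact H]; simpl; intros; lra).
      apply sum_le_length in H'. rewrite Hlen1, S_INR in H'. lra. }
    apply Exists_permutation in Hex. destruct Hex as (c & zs & Htc & P2).
    assert (Hlen2 : length zs = n)
      by (apply Permutation_length in P2; simpl in P2; lia).
    pose proof (Permutation_Forall P2 Hpos2) as Hpos3.
    rewrite (sum_permutation _ _ P2) in Hsum.
    rewrite (prod_permutation _ _ P2) in Hprod.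
    rewrite (sum_permutation _ _ (Permutation_map Rinv P2)).
    clear P2 ys Hlen1 Hpos1 Hpos2.
    inversion Hpos3 as [| ? ? Hc Hpos4]; subst. simpl in Hsum, Hprod |- *.
    assert (Hex : Exists (Rle t) zs).
    { destruct (Exists_dec (Rle t) zs) as [H | H];
        [intros x; apply Rle_dec | exact H |].
      apply Forall_Exists_neg in H. exfalso.
      assert (H' : Forall (fun z => z < t) zs)
        by (eapply Forall_impl; [| exact H]; simpl; intros; lra).
      pose proof (prod_lt_of_all_below t zs ltac:(lra) a c
        ltac:(lra) Hpos4 H') as K.
      rewrite S_INR in K.
      replace (c + (a + sum zs) - (INR (length zs) + 1) * t)
        with u in K by lra.
      specialize (K ltac:(lra)). simpl in K. lra. }
    apply Exists_permutation in Hex. destruct Hex as (b & ws & Htb & P3).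
    pose proof (Permutation_length P3) as Hlen3.
    pose proof (Permutation_Forall P3 Hpos4) as Hpos5.
    rewrite (sum_permutation _ _ P3) in Hsum.
    rewrite (prod_permutation _ _ P3) in Hprod.
    rewrite (sum_permutation _ _ (Permutation_map Rinv P3)).
    inversion Hpos5 as [| ? ? Hb Hpos6]; subst. simpl in Hsum, Hprod |- *.
    destruct (smoothing_step t a b c Ha Hlt Htb Htc)
      as (b' & c' & Hb' & Hc' & Hs & Hp & Hi).
    assert (Hp' : prod (b' :: c' :: ws) = t ^ length zs * u).
    { simpl. apply Rmult_eq_reg_l with t; [| lra].
      replace (t * (b' * (c' * prod ws))) with (t * b' * c' * prod ws) by ring.
      rewrite Hp. lra. }
    specialize (IH t u (b' :: c' :: ws) Htu ltac:(simpl in *; lia)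
      ltac:(repeat constructor; assumption) ltac:(simpl; lra) Hp').
    simpl in IH. unfold Rdiv in *. lra.
Qed.

(** * Reduction to one variable *)

Lemma exists_diagonal_point p :
  0 < p <= 1 / 3125 ->
  exists t, 0 < t <= 1 / 5 /\ t ^ 4 * (1 - 4 * t) = p.
Proof.
  intros Hp.
  destruct (IVT_cor (fun t => t ^ 4 * (1 - 4 * t) - p) 0 (1 / 5))
    as (t & Ht & E); [reg | lra | nra |].
  exists t. split; [| lra].
  destruct Ht as [[Ht0 | <-] Ht5]; [lra |]. simpl in E. lra.
Qed.

Lemma in_domain_prod x1 x2 x3 x4 x5 :
  in_domain x1 x2 x3 x4 x5 -> 0 < x1 * x2 * x3 * x4 * x5 <= 1 / 3125.
Proof.
  intros (H1 & H2 & H3 & H4 & H5 & Hsum). split.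
  - now repeat apply Rmult_lt_0_compat.
  - pose proof (prod_le_exp (1 / 5) [x1; x2; x3; x4; x5]) as H.
    specialize (H ltac:(lra) ltac:(repeat constructor; assumption)).
    simpl in H.
    replace ((x1 + (x2 + (x3 + (x4 + (x5 + 0))))) / (1 / 5)
      - (1 + 1 + 1 + 1 + 1)) with 0 in H by (field_simplify; lra).
    rewrite exp_0 in H. lra.
Qed.

Lemma lhs_ge_diagonal x1 x2 x3 x4 x5 :
  in_domain x1 x2 x3 x4 x5 ->
  exists t, 0 < t <= 1 / 5 /\
    t ^ 4 * (1 - 4 * t) = x1 * x2 * x3 * x4 * x5 /\
    4 / t + / (1 - 4 * t) <= lhs x1 x2 x3 x4 x5.
Proof.
  intros Hdom. destruct (exists_diagonal_point _ (in_domain_prod _ _ _ _ _ Hdom))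
    as (t & Ht & E).
  exists t. split; [exact Ht |]. split; [exact E |].
  destruct Hdom as (H1 & H2 & H3 & H4 & H5 & Hsum).
  pose proof (sum_inv_ge 4 t (1 - 4 * t) [x1; x2; x3; x4; x5]
    ltac:(lra) eq_refl ltac:(repeat constructor; assumption)) as K.
  replace (INR 4) with 4 in K by (simpl; ring).
  specialize (K ltac:(simpl; lra) ltac:(rewrite E; simpl; ring)).
  simpl in K. unfold lhs, Rdiv in *. lra.
Qed.

(** This is [t * (1 - 4 t) * (1 + 10 t + 75 t ^ 2)], expanded; the last factor
    is the cofactor of [(1 - 5 t) ^ 2] in [1 - 125 * t ^ 3 * (4 - 15 t)]. *)
Definition D (t : R) : R := t + 6 * t ^ 2 + 35 * t ^ 3 - 300 * t ^ 4.

Lemma diagonal_identity lambda t :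
  0 < t -> 0 < 1 - 4 * t ->
  (4 / t + / (1 - 4 * t)) * (1 + 125 * (lambda - 25) * (t ^ 4 * (1 - 4 * t)))
    - lambda
  = (1 - 5 * t) ^ 2 * (4 - (lambda - 25) * D t) / (t * (1 - 4 * t)).
Proof. intros. unfold D. field. lra. Qed.

Lemma denominator_pos lambda p :
  0 < lambda -> 0 < p <= 1 / 3125 -> 0 < 1 + 125 * (lambda - 25) * p.
Proof.
  intros Hl Hp. pose proof (Rmult_lt_0_compat _ _ Hl (proj1 Hp)). lra.
Qed.

(** * The optimal point and the optimal constant *)

Lemma sqrt_pow2_22535 : sqrt 22535 ^ 2 = 22535.
Proof. rewrite <- Rsqr_pow2. apply Rsqr_sqrt. lra. Qed.

Lemma alpha_pos : 0 < alpha.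
Proof. apply exp_pos. Qed.

Lemma alpha_cube : alpha ^ 3 = 8119 + 48 * sqrt 22535.
Proof.
  pose proof (sqrt_pos 22535).
  unfold alpha. rewrite <- Rpower_pow by apply exp_pos.
  rewrite Rpower_mult. replace (1 / 3 * INR 3) with 1 by (simpl; field).
  apply Rpower_1; lra.
Qed.

(** The conjugate radical is [241 / alpha]: indeed
    [(8119 + 48 s) * (8119 - 48 s) = 241 ^ 3] for [s ^ 2 = 22535]. *)
Lemma beta_cube : (241 / alpha) ^ 3 = 8119 - 48 * sqrt 22535.
Proof.
  pose proof alpha_pos. pose proof alpha_cube as C.
  pose proof sqrt_pow2_22535 as S.
  apply Rmult_eq_reg_l with (alpha ^ 3); [| apply pow_nonzero; lra].
  replace (alpha ^ 3 * (241 / alpha) ^ 3) with (241 ^ 3) by (field; lra).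
  rewrite C. ring_simplify. rewrite S. ring.
Qed.

Lemma xeq_eq : xeq = (alpha + 241 / alpha + 7) / 240.
Proof. pose proof alpha_pos. unfold xeq. field. lra. Qed.

(** Cardano: [y = alpha + 241 / alpha] solves [y ^ 3 = 16238 + 723 y], which
    is [D' = 0] after the substitution [x = (y + 7) / 240]. *)
Lemma xeq_critical : 1200 * xeq ^ 3 = 105 * xeq ^ 2 + 12 * xeq + 1.
Proof.
  pose proof alpha_pos.
  assert (Y : (alpha + 241 / alpha) ^ 3 = 16238 + 723 * (alpha + 241 / alpha)).
  { replace ((alpha + 241 / alpha) ^ 3)
      with (alpha ^ 3 + (241 / alpha) ^ 3 + 723 * (alpha + 241 / alpha))
      by (field; lra).
    rewrite beta_cube, alpha_cube. ring. }
  rewrite xeq_eq. revert Y. generalize (alpha + 241 / alpha). intros y Y.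
  apply Rminus_diag_uniq.
  replace (1200 * ((y + 7) / 240) ^ 3 - _)
    with ((y ^ 3 - (16238 + 723 * y)) / 11520) by field.
  rewrite Y. field.
Qed.

Lemma xeq_bounds : 0 < xeq < 1 / 5.
Proof.
  pose proof alpha_pos as Ha. pose proof xeq_critical as C.
  assert (Hx : 0 < xeq).
  { rewrite xeq_eq. pose proof (Rdiv_lt_0_compat 241 alpha). lra. }
  split; [exact Hx |].
  destruct (Rlt_le_dec xeq (1 / 5)) as [H | H]; [exact H |]. exfalso.
  assert (H2 : 1 / 5 * xeq <= xeq ^ 2) by (simpl; nra).
  assert (H3 : 1 / 5 * xeq ^ 2 <= xeq ^ 3) by (simpl; nra).
  lra.
Qed.

(** Since [D' xeq = 0], the difference is divisible by [(t - xeq) ^ 2]; the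
    cofactor is positive because [xeq > 4 / 25]. *)
Lemma D_le_D_xeq t : 0 < t -> D t <= D xeq.
Proof.
  intros Ht. pose proof xeq_bounds as Hx. pose proof xeq_critical as C.
  assert (Hlow : 4 / 25 < xeq).
  { destruct (Rlt_le_dec (4 / 25) xeq) as [H | H]; [exact H |]. exfalso.
    assert (H2 : xeq ^ 2 <= 4 / 25 * xeq) by (simpl; nra).
    assert (H3 : xeq ^ 3 <= 4 / 25 * xeq ^ 2) by (simpl; nra).
    lra. }
  assert (E : D xeq - D t = (t - xeq) ^ 2 *
    (300 * t ^ 2 + (600 * xeq - 35) * t + (900 * xeq ^ 2 - 70 * xeq - 6))
    + (xeq - t) * (105 * xeq ^ 2 + 12 * xeq + 1 - 1200 * xeq ^ 3))
    by (unfold D; ring).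
  rewrite C in E.
  assert (0 <= (t - xeq) ^ 2 *
    (300 * t ^ 2 + (600 * xeq - 35) * t + (900 * xeq ^ 2 - 70 * xeq - 6))).
  { apply Rmult_le_pos; [apply pow2_ge_0 |].
    pose proof (pow2_ge_0 t).
    assert (0 < (600 * xeq - 35) * t) by (apply Rmult_lt_0_compat; lra).
    assert (0 < 900 * xeq ^ 2 - 70 * xeq - 6) by (simpl; nra).
    lra. }
  lra.
Qed.

(** The relation for [xeq] lowers the degree of [D xeq] to two; the powers of
    [241 / alpha] are then written as multiples of those of [alpha], through
    [1 / alpha = alpha ^ 2 / alpha ^ 3]. *)
Lemma D_xeq :
  D xeq = 27211 / 409600 + (8119 - 16 * sqrt 22535) / 1228800 * alpha
    + (48611281 - 259808 * sqrt 22535) / 71369932800 * alpha ^ 2.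
Proof.
  pose proof alpha_pos as Ha. pose proof beta_cube as B.
  assert (E : D xeq = 241 / 64 * xeq ^ 2 + 67 / 80 * xeq + 7 / 960
    + (35 / 1200 - 300 / 1200 * xeq - 105 * 300 / 1200 ^ 2)
      * (1200 * xeq ^ 3 - (105 * xeq ^ 2 + 12 * xeq + 1)))
    by (unfold D; field).
  rewrite xeq_critical in E. rewrite E, xeq_eq.
  assert (B1 : 241 / alpha = alpha ^ 2 * (241 / alpha) ^ 3 / 241 ^ 2)
    by (field; lra).
  assert (B2 : (241 / alpha) ^ 2 = alpha * (241 / alpha) ^ 3 / 241)
    by (field; lra).
  rewrite B in B1, B2.
  replace (((alpha + 241 / alpha + 7) / 240) ^ 2)
    with ((alpha ^ 2 + (241 / alpha) ^ 2 + 531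
      + 14 * alpha + 14 * (241 / alpha)) / 57600) by (field; lra).
  rewrite B2, B1. field.
Qed.

(** Reducing the product with [alpha ^ 3 = 8119 + 48 * sqrt 22535] leaves three
    coefficients, of [1], [alpha] and [alpha ^ 2]; they are [4], [0], [0]. *)
Lemma lambda5_D : (lambda5 - 25) * D xeq = 4.
Proof.
  rewrite D_xeq. unfold lambda5.
  generalize alpha_cube, sqrt_pow2_22535.
  generalize alpha (sqrt 22535). intros a s C S.
  assert (S3 : s ^ 3 = 22535 * s)
    by (replace (s ^ 3) with (s ^ 2 * s) by ring; now rewrite S).
  set (l0 := - 288017 / 17161 - 25).
  set (l1 := (12933567 - 93093 * s) / 4135801).
  set (l2 := (17887113 + 560211 * s) / 996728041).
  set (d0 := 27211 / 409600).
  set (d1 := (8119 - 16 * s) / 1228800).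
  set (d2 := (48611281 - 259808 * s) / 71369932800).
  assert (E0 : l0 * d0 + (l1 * d2 + l2 * d1) * (8119 + 48 * s) = 4)
    by (unfold l0, l1, l2, d0, d1, d2; lra).
  assert (E1 : l0 * d1 + l1 * d0 + l2 * d2 * (8119 + 48 * s) = 0)
    by (unfold l0, l1, l2, d0, d1, d2; lra).
  assert (E2 : l0 * d2 + l2 * d0 + l1 * d1 = 0)
    by (unfold l0, l1, l2, d0, d1, d2; lra).
  transitivity (l0 * d0 + (l1 * d2 + l2 * d1) * a ^ 3
    + (l0 * d1 + l1 * d0 + l2 * d2 * a ^ 3) * a
    + (l0 * d2 + l2 * d0 + l1 * d1) * a ^ 2).
  - unfold l0. field.
  - rewrite C, E0, E1, E2. ring.
Qed.

Lemma D_xeq_pos : 0 < D xeq.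
Proof.
  pose proof xeq_bounds as Hx.
  replace (D xeq) with (xeq * ((1 - 4 * xeq) * (1 + 10 * xeq + 75 * xeq ^ 2)))
    by (unfold D; ring).
  pose proof (pow2_ge_0 xeq).
  repeat apply Rmult_lt_0_compat; lra.
Qed.

Lemma lambda5_gt_25 : 25 < lambda5.
Proof.
  pose proof D_xeq_pos as HD. pose proof lambda5_D as E.
  destruct (Rlt_le_dec 25 lambda5) as [H | H]; [exact H |].
  assert (0 <= (25 - lambda5) * D xeq) by (apply Rmult_le_pos; lra).
  lra.
Qed.

Lemma in_domain_xeq : in_domain xeq xeq xeq xeq (1 - 4 * xeq).
Proof. pose proof xeq_bounds. unfold in_domain. lra. Qed.

(** The sign of the right-hand side is that of [lambda5 - lambda], which gives
    both the equality case and the maximality of [lambda5]. *)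
Lemma lhs_xeq lambda :
  lhs xeq xeq xeq xeq (1 - 4 * xeq)
    * (1 + 125 * (lambda - 25) * (xeq * xeq * xeq * xeq * (1 - 4 * xeq)))
    - lambda
  = (1 - 5 * xeq) ^ 2 * ((lambda5 - lambda) * D xeq)
    / (xeq * (1 - 4 * xeq)).
Proof.
  pose proof xeq_bounds as Hx.
  replace ((lambda5 - lambda) * D xeq) with (4 - (lambda - 25) * D xeq)
    by (pose proof lambda5_D; lra).
  rewrite <- diagonal_identity by lra.
  unfold lhs. field. lra.
Qed.

Lemma lambda5_admissible : admissible lambda5.
Proof.
  pose proof lambda5_gt_25 as H25. split; [lra |].
  intros x1 x2 x3 x4 x5 Hdom.
  pose proof (denominator_pos lambda5 _ ltac:(lra)
    (in_domain_prod _ _ _ _ _ Hdom)) as Hden.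
  destruct (lhs_ge_diagonal _ _ _ _ _ Hdom) as (t & Ht & E & Hlhs).
  unfold rhs. rewrite <- E in *.
  set (den := 1 + 125 * (lambda5 - 25) * (t ^ 4 * (1 - 4 * t))) in *.
  apply Rle_ge. apply Rle_trans with (2 := Hlhs).
  apply Rmult_le_reg_r with den; [exact Hden |].
  unfold Rdiv at 1. rewrite Rmult_assoc, Rinv_l, Rmult_1_r by lra.
  pose proof (diagonal_identity lambda5 t ltac:(lra) ltac:(lra)) as K.
  fold den in K.
  assert (0 <= (1 - 5 * t) ^ 2 * (4 - (lambda5 - 25) * D t)
    / (t * (1 - 4 * t))).
  { apply Rmult_le_pos.
    - apply Rmult_le_pos; [apply pow2_ge_0 |].
      rewrite <- lambda5_D.
      pose proof (Rmult_le_compat_l (lambda5 - 25) _ _ ltac:(lra)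
        (D_le_D_xeq t ltac:(lra))). lra.
    - apply Rlt_le, Rinv_0_lt_compat, Rmult_lt_0_compat; lra. }
  lra.
Qed.

(** For [lambda > lambda5] the inequality fails at the point given by [xeq]. *)
Lemma admissible_le_lambda5 lambda : admissible lambda -> lambda <= lambda5.
Proof.
  intros [Hl H]. pose proof xeq_bounds as Hx.
  specialize (H _ _ _ _ _ in_domain_xeq). unfold rhs in H.
  pose proof (denominator_pos lambda _ Hl
    (in_domain_prod _ _ _ _ _ in_domain_xeq)) as Hden.
  pose proof (lhs_xeq lambda) as K.
  set (den := 1 + _) in *. apply Rge_le in H.
  apply (Rmult_le_compat_r den) in H; [| lra].
  unfold Rdiv at 1 in H. rewrite Rmult_assoc, Rinv_l, Rmult_1_r in H by lra.
  destruct (Rle_lt_dec lambda lambda5) as [? | Hlt]; [assumption |].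
  assert (0 < (1 - 5 * xeq) ^ 2 * ((lambda - lambda5) * D xeq)
    / (xeq * (1 - 4 * xeq))).
  { pose proof D_xeq_pos.
    apply Rdiv_lt_0_compat; [| apply Rmult_lt_0_compat; lra].
    apply Rmult_lt_0_compat; [apply pow_lt; lra |].
    apply Rmult_lt_0_compat; lra. }
  unfold Rdiv in *. lra.
Qed.

Theorem mainTheorem3 :
  is_maximum admissible lambda5 /\
  equality_at lambda5 (1 / 5) (1 / 5) (1 / 5) (1 / 5) (1 / 5) /\
  equality_at lambda5 xeq xeq xeq xeq (1 - 4 * xeq).
Proof.
  pose proof lambda5_gt_25 as H25.
  split; [exact (conj lambda5_admissible admissible_le_lambda5) |]. split.
  - split; [unfold in_domain; lra |]. unfold lhs, rhs. field. lra.
  - split; [exact in_domain_xeq |]. unfold rhs.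
    pose proof (denominator_pos lambda5 _ ltac:(lra)
      (in_domain_prod _ _ _ _ _ in_domain_xeq)) as Hden.
    pose proof (lhs_xeq lambda5) as K.
    set (den := 1 + _) in *.
    apply Rmult_eq_reg_r with den; [| lra].
    unfold Rdiv at 1. rewrite Rmult_assoc, Rinv_l, Rmult_1_r by lra.
    rewrite Rminus_diag, Rmult_0_l, Rmult_0_r in K. unfold Rdiv in K. lra.
Qed.
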